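(* Let $\bar x$ belong to the feasible region $\Omega_C$ of the MPCC (see context) and assume that GGCQ is fulfilled at $\bar x$. Further assume that there is some partition $(\beta_1,\beta_2)$ of the index set $I^{00}$ such that for every $\mu=(\mu^h,\mu^g,\mu^G,\mu^H)\in\mathcal N_{CC}$ we have \begin{align*} &\mu_i^G\mu_{i'}^G\geq 0,\ \mu_i^H\mu_{i'}^H\geq 0\quad \forall (i,i')\in\beta_1\times\beta_2,\\ &\mu_i^G\mu_{i'}^H\geq 0\quad \forall (i,i')\in\beta_1\times\beta_1,\\ &\mu_i^G\mu_{i'}^H\geq 0\quad \forall (i,i')\in\beta_2\times\beta_2. \end{align*} Then $$\widehat N_{\Omega_C}(\bar x)=M^{\beta_1,\beta_2}_{CC}=\nabla F(\bar x)^T\widehat N_D(F(\bar x)).$$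
   Context: For $\Gamma\subset\mathbb{R}^d$, $\bar z\in\Gamma$: $T_\Gamma(\bar z)=\{u\mid \exists t_k\searrow 0,\ u_k\to u:\ \bar z+t_ku_k\in\Gamma\ \forall k\}$, $\widehat N_\Gamma(\bar z)=(T_\Gamma(\bar z))^\circ$, where $K^\circ=\{z^*\mid \langle z^*,u\rangle\le 0\ \forall u\in K\}$. MPCC: minimize $f(x)$ subject to $h(x)=0$, $g(x)\le 0$, $0\le G(x)\perp H(x)\ge 0$, with $f:\mathbb{R}^n\to\mathbb{R}$, $h:\mathbb{R}^n\to\mathbb{R}^{m_E}$, $g:\mathbb{R}^n\to\mathbb{R}^{m_I}$, $G,H:\mathbb{R}^n\to\mathbb{R}^{m_C}$ continuously differentiable. Its feasible set is $\Omega_C=\{x\mid F(x)\in D\}$ with $F(x)=(h(x),g(x),-G_1(x),-H_1(x),\ldots,-G_{m_C}(x),-H_{m_C}(x))$, $D=\{0\}^{m_E}\times\mathbb{R}_-^{m_I}\times D_C^{m_C}$, $D_C=\{(a,b)\in\mathbb{R}_-^2\mid ab=0\}$. GGCQ at $\bar x$: $(T_{\Omega_C}(\bar x))^\circ=\{u\mid\nabla F(\bar x)u\in T_D(F(\bar x))\}^\circ$. Index sets: $I^g=\{i\mid g_i(\bar x)=0\}$, $I^{0+}=\{i\mid G_i(\bar x)=0<H_i(\bar x)\}$, $I^{00}=\{i\mid G_i(\bar x)=0=H_i(\bar x)\}$, $I^{+0}=\{i\mid G_i(\bar x)>0=H_i(\bar x)\}$. A partition $(\beta_1,\beta_2)$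 of $I^{00}$ satisfies $\beta_1\cup\beta_2=I^{00}$, $\beta_1\cap\beta_2=\emptyset$ (either may be empty). Let \begin{align*} \mathcal R_{CC}=\{(\mu^h,\mu^g,\mu^G,\mu^H)\in\mathbb{R}^{m_E}\times\mathbb{R}^{m_I}\times\mathbb{R}^{m_C}\times\mathbb{R}^{m_C}\mid\ &\mu_i^g=0,\ i\notin I^g;\ \mu_i^G=0,\ i\in I^{+0};\ \mu_i^H=0,\ i\in I^{0+}\}, \end{align*} $$\mathcal N_{CC}=\Big\{\mu\in\mathcal R_{CC}\ \Big|\ \sum_{i=1}^{m_E}\mu_i^h\nabla h_i(\bar x)+\sum_{i=1}^{m_I}\mu_i^g\nabla g_i(\bar x)-\sum_{i=1}^{m_C}(\mu_i^G\nabla G_i(\bar x)+\mu_i^H\nabla H_i(\bar x))=0\Big\}.$$ Let $\tilde N^{\beta_1,\beta_2}_{CC}$ be the set of all $(\lambda^h,\lambda^g,\lambda^G,\lambda^H)\in\mathcal R_{CC}$ for which there is $(\mu^h,\mu^g,\mu^G,\mu^H)\in\mathcal N_{CC}$ with $\lambda_i^g\ge\max\{\mu_i^g,0\}$ for $i\in I^g$; $\lambda_i^G\ge\mu_i^G$, $\lambda_i^H\ge 0$ for $i\in\beta_1$; $\lambda_i^G\ge 0$, $\lambda_i^H\ge\mu_i^H$ for $i\in\beta_2$. Finally $$M^{\beta_1,\beta_2}_{CC}=\Big\{\sum_{i=1}^{m_E}\lambda_i^h\nabla h_i(\bar x)+\sum_{i=1}^{m_I}\lambda_i^g\nabla g_i(\bar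 x)-\sum_{i=1}^{m_C}(\lambda_i^G\nabla G_i(\bar x)+\lambda_i^H\nabla H_i(\bar x))\ \Big|\ (\lambda^h,\lambda^g,\lambda^G,\lambda^H)\in\tilde N^{\beta_1,\beta_2}_{CC}\Big\}.$$ *)

(* Defs.v *)
(* R^n is the type 'rV[R]_n of row vectors, for R an abstract model of the reals. *)
From HB Require Import structures.
From mathcomp Require Import all_boot all_order all_algebra.
From mathcomp Require Import all_classical all_reals all_analysis.
Set Implicit Arguments.
Unset Strict Implicit.
Unset Printing Implicit Defensive.
Import Order.TTheory GRing.Theory Num.Theory.
Import numFieldNormedType.Exports.
Local Open Scope classical_set_scope.
Local Open Scope ring_scope.

Section VariationalAnalysis.
Context {R : realType}.

Definition dot {d : nat} (u v : 'rV[R]_d) : R := \sum_(i < d) u 0 i * v 0 i.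

(* [t_k \searrow 0] is read as: positive and convergent to 0. Requiring t to be
   monotone as well gives the same cone (pass to a subsequence). *)
Definition tangent_cone {d : nat} (Gamma : set 'rV[R]_d) (z : 'rV[R]_d) :
    set 'rV[R]_d :=
  [set u | exists (t : nat -> R) (v : nat -> 'rV[R]_d),
    [/\ forall k, 0 < t k, t @ \oo --> (0 : R), v @ \oo --> u
      & forall k, Gamma (z + t k *: v k)]].

Definition polar {d : nat} (K : set 'rV[R]_d) : set 'rV[R]_d :=
  [set y | forall u, K u -> dot y u <= 0].

Definition regular_normal_cone {d : nat} (Gamma : set 'rV[R]_d)
    (z : 'rV[R]_d) : set 'rV[R]_d :=
  polar (tangent_cone Gamma z).

(* As the domain is finite-dimensional, continuity of x |-> 'd f x v for every
   fixed v is the same as continuity of x |-> 'd f x in operator norm. *)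
Definition cont_diff {n : nat} {W : normedModType R} (f : 'rV[R]_n -> W) : Prop :=
  (forall x, differentiable f x) /\
  (forall v, continuous (fun x => 'd f x v)).

Definition grad {n : nat} (f : 'rV[R]_n -> R) (x : 'rV[R]_n) : 'rV[R]_n :=
  \row_(j < n) 'D_(delta_mx 0 j) f x.

End VariationalAnalysis.

(* minimize f x  subject to  h x = 0, g x <= 0, 0 <= G x _|_ H x >= 0 *)
Record mpcc (R : realType) (n mE mI mC : nat) := MPCC {
  obj : 'rV[R]_n -> R;
  eqc : 'rV[R]_n -> 'rV[R]_mE;
  ineqc : 'rV[R]_n -> 'rV[R]_mI;
  compG : 'rV[R]_n -> 'rV[R]_mC;
  compH : 'rV[R]_n -> 'rV[R]_mC;
  obj_cont_diff : cont_diff obj;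
  eqc_cont_diff : cont_diff eqc;
  ineqc_cont_diff : cont_diff ineqc;
  compG_cont_diff : cont_diff compG;
  compH_cont_diff : cont_diff compH
}.

Record multiplier (R : realType) (mE mI mC : nat) := Multiplier {
  mult_h : 'rV[R]_mE;
  mult_g : 'rV[R]_mI;
  mult_G : 'rV[R]_mC;
  mult_H : 'rV[R]_mC
}.

Section MPCCDefs.
Context {R : realType} {n mE mI mC : nat}.
Variable P : mpcc R n mE mI mC.
Implicit Types (x : 'rV[R]_n) (mu lambda : multiplier R mE mI mC).

(* [mxvec] flattens the mC x 2 matrix row by row, so the last block of F x is
   (- G_1 x, - H_1 x, ..., - G_mC x, - H_mC x). *)
Definition mpccF x : 'rV[R]_(mE + (mI + mC * 2)) :=
  row_mx (eqc P x) (row_mx (ineqc P x)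
    (mxvec (\matrix_(i < mC, j < 2)
       (if j == 0 then - compG P x 0 i else - compH P x 0 i)))).

Definition DC : set 'rV[R]_2 :=
  [set p | [/\ p 0 0 <= 0, p 0 1 <= 0 & p 0 0 * p 0 1 = 0]].

Definition mpccD : set 'rV[R]_(mE + (mI + mC * 2)) :=
  [set z | [/\ forall i, lsubmx z 0 i = 0,
               forall i, lsubmx (rsubmx z) 0 i <= 0
             & forall i, DC (row i (vec_mx (rsubmx (rsubmx z))))]].

Definition feasible : set 'rV[R]_n := [set x | mpccD (mpccF x)].

(* The library's Jacobian acts on row vectors from the right, i.e.
   u *m 'J f x = 'd f x u: it is the transpose of the usual one, so that the
   linearized map is u |-> u *m 'J F x and its adjoint y |-> y *m ('J F x)^T. *)
Definition linearized_cone x : set 'rV[R]_n :=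
  [set u | tangent_cone mpccD (mpccF x) (u *m 'J mpccF x)].

Definition GGCQ x : Prop :=
  polar (tangent_cone feasible x) = polar (linearized_cone x).

Definition adjoint_image x (N : set 'rV[R]_(mE + (mI + mC * 2))) :
    set 'rV[R]_n :=
  [set y *m ('J mpccF x)^T | y in N].

Definition Ig x : {set 'I_mI} := [set i | ineqc P x 0 i == 0]%SET.
Definition I0p x : {set 'I_mC} :=
  [set i | (compG P x 0 i == 0) && (0 < compH P x 0 i)]%SET.
Definition I00 x : {set 'I_mC} :=
  [set i | (compG P x 0 i == 0) && (compH P x 0 i == 0)]%SET.
Definition Ip0 x : {set 'I_mC} :=
  [set i | (0 < compG P x 0 i) && (compH P x 0 i == 0)]%SET.

Definition RCC x : set (multiplier R mE mI mC) :=
  [set mu | [/\ forall i, i \notin Ig x -> mult_g mu 0 i = 0,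
                forall i, i \in Ip0 x -> mult_G mu 0 i = 0
              & forall i, i \in I0p x -> mult_H mu 0 i = 0]].

Definition grad_comb x lambda : 'rV[R]_n :=
  \sum_(i < mE) mult_h lambda 0 i *: grad (fun z => eqc P z 0 i) x
  + \sum_(i < mI) mult_g lambda 0 i *: grad (fun z => ineqc P z 0 i) x
  - \sum_(i < mC) (mult_G lambda 0 i *: grad (fun z => compG P z 0 i) x
                   + mult_H lambda 0 i *: grad (fun z => compH P z 0 i) x).

Definition NCC x : set (multiplier R mE mI mC) :=
  [set mu | RCC x mu /\ grad_comb x mu = 0].

Definition tildeNCC x (beta1 beta2 : {set 'I_mC}) :
    set (multiplier R mE mI mC) :=
  [set lambda | RCC x lambda /\ exists2 mu, NCC x mu &
    [/\ forall i, i \in Ig x ->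
          Num.max (mult_g mu 0 i) 0 <= mult_g lambda 0 i,
        forall i, i \in beta1 ->
          mult_G mu 0 i <= mult_G lambda 0 i /\ 0 <= mult_H lambda 0 i
      & forall i, i \in beta2 ->
          0 <= mult_G lambda 0 i /\ mult_H mu 0 i <= mult_H lambda 0 i]].

Definition MCC x (beta1 beta2 : {set 'I_mC}) : set 'rV[R]_n :=
  [set grad_comb x lambda | lambda in tildeNCC x beta1 beta2].

Definition is_partition_I00 x (beta1 beta2 : {set 'I_mC}) : Prop :=
  (beta1 :|: beta2 = I00 x)%SET /\ (beta1 :&: beta2 = finset.set0)%SET.

End MPCCDefs.

(* Main.v *)
Require Import Defs.
From HB Require Import structures.
From mathcomp Require Import all_boot all_order all_algebra.
From mathcomp Require Import all_classical all_reals all_analysis.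
From mathcomp Require Import ring lra.
Import Order.TTheory GRing.Theory Num.Theory.
Import numFieldNormedType.Exports.
Local Open Scope classical_set_scope.
Local Open Scope ring_scope.

(** The chain of inclusions
<<
  regular normal cone of the feasible set
    = polar of the linearized cone       (this is GGCQ)
    <= MCC                               (polar_linearized_sub_MCC)
    <= adjoint image of the normal cone of mpccD
                                         (MCC_sub_adjoint_normal)
    <= polar of the linearized cone      (adjoint_normal_sub_polar)
>>
    closes on itself, so all its terms are equal. The last inclusion is just
    the definition of the adjoint.

    For the first inclusion, the linearized cone is a union of polyhedral
    branches: for every subset [A] of the biactive indices one branch requires
    the linearization of [G] to vanish on [A] and that of [H] off [A]. A vector
    [y] of the polar is in the polar of each branch, and Farkas' lemma turns
    this into a multiplier of [y] whose sign is prescribed, at each biactive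
    index, in one of the components [G] and [H] only. The branches [A = beta1]
    and [A = beta2] prescribe opposite components. Their multipliers [l] and
    [l'] represent the same vector, so [mu = l - l'] lies in NCC, and [l], [mu]
    satisfy the inequalities that define MCC.

    For the second inclusion, let [l] and [mu] be as in the definition of MCC.
    The sign condition forces one of the two multipliers [l] and [l - mu],
    which represent the same vector, to be nonnegative in both components at
    all biactive indices. Either [mu] is nonnegative in its [G]-components on
    beta1 and its [H]-components on beta2, and [l] dominates them there, or one
    negative component makes [mu] nonpositive in its [H]-components on beta1
    and its [G]-components on beta2, and then [l - mu] is nonnegative.
    The multiplier found in this way is a normal of mpccD
    (strong_multiplier_normal). *)

(** * The inner product and Farkas' lemma *)

Section DotProduct.
Context {R : realType} {d : nat}.
Implicit Types (u v w : 'rV[R]_d).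

Lemma dotC u v : dot u v = dot v u.
Proof. by apply: eq_bigr => i _; rewrite mulrC. Qed.

Lemma dotDl u v w : dot (u + v) w = dot u w + dot v w.
Proof.
by rewrite /dot -big_split; apply: eq_bigr => i _; rewrite mxE mulrDl.
Qed.

Lemma dotZl c u v : dot (c *: u) v = c * dot u v.
Proof.
by rewrite /dot big_distrr; apply: eq_bigr => i _; rewrite mxE /= mulrA.
Qed.

Lemma dotZr c u v : dot u (c *: v) = c * dot u v.
Proof. by rewrite !(dotC u) dotZl. Qed.

Lemma dotNl u v : dot (- u) v = - dot u v.
Proof. by rewrite -scaleN1r dotZl mulN1r. Qed.

Lemma dotBl u v w : dot (u - v) w = dot u w - dot v w.
Proof. by rewrite dotDl dotNl. Qed.

Lemma dotBr u v w : dot u (v - w) = dot u v - dot u w.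
Proof. by rewrite !(dotC u) dotBl. Qed.

Lemma dot_suml (I : Type) (r : seq I) (a : I -> 'rV[R]_d) w :
  dot (\sum_(i <- r) a i) w = \sum_(i <- r) dot (a i) w.
Proof.
elim: r => [|i r IH]; last by rewrite !big_cons dotDl IH.
by rewrite !big_nil /dot big1 // => i _; rewrite mxE mul0r.
Qed.

Lemma dot_delta u j : dot u (delta_mx 0 j) = u 0 j.
Proof.
rewrite /dot (bigD1 j) //= big1 ?addr0 => [|i nij]; rewrite mxE eqxx /=.
  by rewrite eqxx mulr1.
by rewrite (negPf nij) mulr0.
Qed.

Lemma dot_inj u v : (forall w, dot u w = dot v w) -> u = v.
Proof. by move=> uv; apply/rowP => j; rewrite -!dot_delta uv. Qed.

End DotProduct.

Lemma dot_mulmx_tr (R : realType) (n m : nat) (y : 'rV[R]_m) (J : 'M[R]_(n, m))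
  (u : 'rV[R]_n) : dot (y *m J^T) u = dot y (u *m J).
Proof.
have dotE d (a b : 'rV[R]_d) : dot a b = (a *m b^T) 0 0.
  by rewrite mxE; apply: eq_bigr => i _; rewrite mxE.
by rewrite !dotE trmx_mul mulmxA.
Qed.

(** Farkas' lemma for a mixed system of equations and inequalities, by
    induction on the constraints. If dropping the constraint [k] loses the
    conclusion, some [u0] meets the other constraints, has [dot y u0 > 0] and
    hence violates [k]; projecting all data along [u0] onto the hyperplane
    orthogonal to [a k] leaves an instance of the shorter system. *)
Lemma farkas (R : realType) (d : nat) (I : eqType) (s : seq I)
    (eqs : pred I) (a : I -> 'rV[R]_d) (y : 'rV[R]_d) : uniq s ->
  (forall u, (forall i, i \in s -> eqs i -> dot (a i) u = 0) ->
             (forall i, i \in s -> ~~ eqs i -> dot (a i) u <= 0) ->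
     dot y u <= 0) ->
  exists2 c : I -> R, y = \sum_(i <- s) c i *: a i
    & forall i, i \in s -> ~~ eqs i -> 0 <= c i.
Proof.
elim: s a y => [|k s IH] a y /=.
  move=> _ ypol; exists (fun=> 0) => //; rewrite big_nil.
  apply/rowP => j; rewrite mxE; apply/eqP; rewrite eq_le -dot_delta.
  by rewrite ypol //= -oppr_le0 dotC -dotNl dotC ypol.
move=> /andP[kNs s_uniq] ypol.
have [ypol_s|] := pselect (forall u,
    (forall i, i \in s -> eqs i -> dot (a i) u = 0) ->
    (forall i, i \in s -> ~~ eqs i -> dot (a i) u <= 0) -> dot y u <= 0).
  have [c yE c_ge0] := IH a y s_uniq ypol_s.
  exists (fun i => if i == k then 0 else c i) => [|i].
    rewrite big_cons eqxx scale0r add0r yE.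
    by apply: eq_big_seq => i si; case: eqP => // ik; rewrite -ik si in kNs.
  by rewrite inE; case: eqP => //= _ si; exact: c_ge0.
move=> /existsNP[u0 /not_implyP[u0eq /not_implyP[u0le /negP]]].
rewrite -ltNge => yu0.
set al := dot (a k) u0.
(* The constraint [k] fails at [u0], as otherwise [y] would be
   nonpositive there. *)
have al_eq : eqs k -> al != 0.
  move=> ek; apply/eqP => al0; suff: dot y u0 <= 0 by rewrite leNgt yu0.
  by apply: ypol => i /predU1P[->|] //;
    [exact: u0eq | rewrite ek | exact: u0le].
have al_le : ~~ eqs k -> 0 < al.
  move=> ek; rewrite ltNge; apply/negP => al0.
  suff: dot y u0 <= 0 by rewrite leNgt yu0.
  by apply: ypol => i /predU1P[->|] //;
    [rewrite (negPf ek) | exact: u0eq | exact: u0le].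
have al0 : al != 0 by case: (boolP (eqs k)) => [/al_eq|/al_le/lt0r_neq0].
(* [proj b] is the form [b] evaluated at the projection of its argument onto
   the hyperplane [dot (a k) u = 0] along [u0]. *)
pose proj b := b - (dot b u0 / al) *: a k.
have dot_proj b u : dot (proj b) u = dot b (u - (dot (a k) u / al) *: u0).
  rewrite /proj dotBl dotZl dotBr dotZr; field.
  exact: al0.
have [u u_eq u_le|c yE c_ge0] := IH (proj \o a) (proj y) s_uniq.
  rewrite dot_proj; apply: ypol => i /predU1P[->|si] ei.
  - by rewrite dotBr dotZr -/al divfK ?subrr.
  - by rewrite -dot_proj; exact: u_eq.
  - by rewrite dotBr dotZr -/al divfK ?subrr.
  - by rewrite -dot_proj; exact: u_le.
exists (fun i => if i == k
    then (dot y u0 - \sum_(j <- s) c j * dot (a j) u0) / al else c i) => [|i].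
  rewrite big_cons eqxx.
  rewrite (eq_big_seq (fun i => c i *: a i)); last first.
    by move=> i si; case: eqP => // ik; rewrite -ik si in kNs.
  (* Undoing [proj] in the representation [yE] of [proj y] collects all the
     multiples of [a k] in a single coefficient. *)
  rewrite [LHS](canRL (subrK _) yE) mulrBl scalerBl addrC -addrA.
  congr (_ + _).
  rewrite (eq_bigr (fun i => c i *: a i - (c i * dot (a i) u0 / al) *: a k)).
    by rewrite sumrB addrC -scaler_suml mulr_suml.
  by move=> i _; rewrite /= /proj scalerBr scalerA mulrA.
rewrite inE; case: eqP => [-> _ ek|_ /= si]; last exact: c_ge0.
apply: divr_ge0; last exact: ltW (al_le ek).
apply: ltW (lt_le_trans yu0 _); rewrite lerDl oppr_ge0.
rewrite big_seq; apply: sumr_le0 => j sj.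
have [ej|ej] := boolP (eqs j); first by rewrite u0eq // mulr0.
by rewrite mulr_ge0_le0 ?u0le ?c_ge0.
Qed.

(** * Gradients and Jacobians *)

Section Jacobian.
Context {R : realType} {n m : nat}.
Implicit Types (f : 'rV[R]_n -> 'rV[R]_m) (x u : 'rV[R]_n).

Lemma differentiable_coord_comp f x j :
  differentiable f x -> differentiable (fun z => f z 0 j) x.
Proof.
move=> fx.
apply: (@differentiable_comp _ _ _ _ f (fun N : 'rV[R]_m => N 0 j)) => //.
exact: differentiable_coord.
Qed.

Lemma differentiable_rowP f x :
  (forall j, differentiable (fun z => f z 0 j) x) -> differentiable f x.
Proof.
move=> fx; have -> : f = \sum_(j < m) (fun z => f z 0 j *: delta_mx 0 j).
  by apply/funext => z; rewrite fct_sumE; exact: row_sum_delta.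
by apply: differentiable_sum => j; exact: differentiableZl.
Qed.

Lemma dot_grad (g : 'rV[R]_n -> R) x u : differentiable g x ->
  dot (grad g x) u = 'd g x u.
Proof.
move=> gx; rewrite [in RHS](row_sum_delta u) linear_sum /dot.
by apply: eq_bigr => j _; rewrite mxE deriveE // linearZ /= mulrC.
Qed.

Lemma mulmx_jacobian f x u j : differentiable f x ->
  (u *m 'J f x) 0 j = dot (grad (fun z => f z 0 j) x) u.
Proof.
move=> fx; rewrite -deriveEjacobian // derive_mx ?mxE;
  last exact: diff_derivable.
by rewrite dot_grad ?deriveE //; exact: differentiable_coord_comp.
Qed.

Lemma gradN (g : 'rV[R]_n -> R) x : differentiable g x ->
  grad (fun z => - g z) x = - grad g x.
Proof.
move=> gx; apply: dot_inj => u; rewrite dotNl !dot_grad //;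
  last exact: differentiableN.
by rewrite diffN.
Qed.

End Jacobian.

(** * Tangent directions *)

Lemma near_right_lt0 (R : realType) (a b : R) : a < 0 ->
  \forall t \near 0^'+, a + t * b < 0.
Proof.
move=> a0; apply: (cvgr_lt (a + 0 * b)); last by rewrite mul0r addr0.
apply: cvgD; first exact: cvg_cst.
by apply: cvgM; [exact: cvg_within | exact: cvg_cst].
Qed.

Section TangentCone.
Context {R : realType} {d : nat}.
Implicit Types (Gamma : set 'rV[R]_d) (z u : 'rV[R]_d).

(** The constant sequence [u] is a witness, with step sizes scaled into the
    range where the ray stays in [Gamma]. *)
Lemma tangent_cone_near Gamma z u :
  (\forall t \near 0^'+, Gamma (z + t *: u)) -> tangent_cone Gamma z u.
Proof.
rewrite near_withinE => -[e /= e0 eG].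
exists (fun k => e / 2 * harmonic k), (fun=> u); split => [k||//|k].
- by rewrite mulr_gt0 ?divr_gt0 // harmonic_gt0.
- by rewrite -(mulr0 (e / 2)); apply: cvgMr; exact: cvg_harmonic.
- exact: cvg_cst.
have tk0 : 0 < e / 2 * k.+1%:R^-1 by rewrite mulr_gt0 ?divr_gt0 // invr_gt0.
apply: eG; last exact: tk0.
rewrite /= sub0r normrN gtr0_norm //.
rewrite (@le_lt_trans _ _ (e / 2)) //; last lra.
rewrite ger_pMr ?divr_gt0 // invf_le1 ?ltr0n //.
by rewrite ler1n.
Qed.

Lemma cvg_row_coord (v : nat -> 'rV[R]_d) u j :
  v @ \oo --> u -> (fun k => v k 0 j) @ \oo --> u 0 j.
Proof.
by move=> vu; exact: (continuous_cvg _ (@coord_continuous _ _ _ 0 j u) vu).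
Qed.

(** An equality of the limit coordinate is covered as well, by applying the
    bound with a multiplier [c] of either sign. *)
Lemma limit_coord_mul_le0 (v : nat -> 'rV[R]_d) u j (c : R) :
  v @ \oo --> u -> (\forall k \near \oo, c * v k 0 j <= 0) -> c * u 0 j <= 0.
Proof.
move=> /(cvg_row_coord _ _ j) vu; apply: cvgr_to_le; apply: cvgMr; exact: vu.
Qed.

Lemma near_moved_coord_lt0 (t : nat -> R) (v : nat -> 'rV[R]_d) z u j :
  t @ \oo --> (0 : R) -> v @ \oo --> u -> z 0 j < 0 ->
  \forall k \near \oo, z 0 j + t k * v k 0 j < 0.
Proof.
move=> t0 /(cvg_row_coord _ _ j) vu zj; apply: cvgr_lt zj.
rewrite -[in X in _ --> X](addr0 (z 0 j)) -(mul0r (u 0 j)).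
by apply: cvgD; [exact: cvg_cst | exact: cvgM].
Qed.

Lemma coord_move z u (t : R) j : (z + t *: u) 0 j = z 0 j + t * u 0 j.
Proof. by rewrite !mxE. Qed.

End TangentCone.

(** * Multipliers as vectors of the image space *)

Section Blocks.
Context {R : realType} {mE mI mC : nat}.

(** The positions, in the vectors of the image space of [mpccF], of the entries
    attached to the equality, inequality and complementarity constraints. *)
Definition idx_h (i : 'I_mE) : 'I_(mE + (mI + mC * 2)) := lshift _ i.
Definition idx_g (i : 'I_mI) : 'I_(mE + (mI + mC * 2)) := rshift _ (lshift _ i).
Definition idx_G (i : 'I_mC) : 'I_(mE + (mI + mC * 2)) :=
  rshift _ (rshift _ (mxvec_index i 0)).
Definition idx_H (i : 'I_mC) : 'I_(mE + (mI + mC * 2)) :=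
  rshift _ (rshift _ (mxvec_index i 1)).

Lemma idx_ind (T : 'I_(mE + (mI + mC * 2)) -> Prop) :
  (forall i, T (idx_h i)) -> (forall i, T (idx_g i)) ->
  (forall i, T (idx_G i)) -> (forall i, T (idx_H i)) -> forall k, T k.
Proof.
move=> Th Tg TG TH k; case: (split_ordP k) => [i ->|k' ->]; first exact: Th.
case: (split_ordP k') => [i ->|k'' ->]; first exact: Tg.
case: (mxvec_indexP k'') => i j.
have [->|] := eqVneq j 0; first exact: TG.
case: j => -[|[|//]] //= j2 _; have -> : Ordinal j2 = 1 by exact: val_inj.
exact: TH.
Qed.

Lemma big_idx (f : 'I_(mE + (mI + mC * 2)) -> R) :
  \sum_k f k = \sum_i f (idx_h i) + (\sum_i f (idx_g i)
               + \sum_i (f (idx_G i) + f (idx_H i))).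
Proof.
rewrite !big_split_ord; do 2 congr (_ + _).
rewrite (reindex _ (curry_mxvec_bij _ _)) /=.
rewrite (eq_bigr (fun p => f (rshift _ (rshift _ (mxvec_index p.1 p.2))))).
  rewrite -(pair_bigA _ (fun i j =>
    f (rshift _ (rshift _ (mxvec_index i j))))) /=.
  apply: eq_bigr => i _; rewrite big_ord_recl big_ord1; congr (_ + f _).
  by congr (rshift _ (rshift _ (mxvec_index i _))); exact: val_inj.
by case.
Qed.

Definition pack (l : multiplier R mE mI mC) : 'rV[R]_(mE + (mI + mC * 2)) :=
  row_mx (mult_h l) (row_mx (mult_g l) (mxvec (\matrix_(i < mC, j < 2)
    (if j == 0 then mult_G l 0 i else mult_H l 0 i)))).

Lemma pack_h l i : pack l 0 (idx_h i) = mult_h l 0 i.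
Proof. by rewrite row_mxEl. Qed.

Lemma pack_g l i : pack l 0 (idx_g i) = mult_g l 0 i.
Proof. by rewrite row_mxEr row_mxEl. Qed.

Lemma pack_G l i : pack l 0 (idx_G i) = mult_G l 0 i.
Proof. by rewrite !row_mxEr mxvecE mxE. Qed.

Lemma pack_H l i : pack l 0 (idx_H i) = mult_H l 0 i.
Proof. by rewrite !row_mxEr mxvecE mxE. Qed.

Definition packE := (pack_h, pack_g, pack_G, pack_H).

Lemma mpccDE (z : 'rV[R]_(mE + (mI + mC * 2))) :
  mpccD z <-> [/\ forall i, z 0 (idx_h i) = 0, forall i, z 0 (idx_g i) <= 0
    & forall i, [/\ z 0 (idx_G i) <= 0, z 0 (idx_H i) <= 0
                  & z 0 (idx_G i) * z 0 (idx_H i) = 0]].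
Proof.
rewrite /mpccD /DC /=; split=> -[zh zg zGH]; split=> i.
- by move: (zh i); rewrite mxE.
- by move: (zg i); rewrite !mxE.
- by move: (zGH i); rewrite !mxE.
- by rewrite mxE; exact: zh.
- by rewrite !mxE; exact: zg.
- by rewrite !mxE; exact: zGH.
Qed.

End Blocks.

(** * The Jacobian of the constraint map *)

Section LinearizedMPCC.
Context {R : realType} {n mE mI mC : nat} (P : mpcc R n mE mI mC).
Implicit Types (x u : 'rV[R]_n) (l mu : multiplier R mE mI mC).

Lemma mpccF_h x i : mpccF P x 0 (idx_h i) = eqc P x 0 i.
Proof. by rewrite row_mxEl. Qed.

Lemma mpccF_g x i : mpccF P x 0 (idx_g i) = ineqc P x 0 i.
Proof. by rewrite row_mxEr row_mxEl. Qed.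

Lemma mpccF_G x i : mpccF P x 0 (idx_G i) = - compG P x 0 i.
Proof. by rewrite !row_mxEr mxvecE mxE. Qed.

Lemma mpccF_H x i : mpccF P x 0 (idx_H i) = - compH P x 0 i.
Proof. by rewrite !row_mxEr mxvecE mxE. Qed.

Definition mpccFE := (mpccF_h, mpccF_g, mpccF_G, mpccF_H).

Lemma differentiable_coords x :
  [/\ forall i, differentiable (fun z => eqc P z 0 i) x,
      forall i, differentiable (fun z => ineqc P z 0 i) x,
      forall i, differentiable (fun z => compG P z 0 i) x
    & forall i, differentiable (fun z => compH P z 0 i) x].
Proof.
split=> i; apply: differentiable_coord_comp.
- exact: (eqc_cont_diff P).1.
- exact: (ineqc_cont_diff P).1.
- exact: (compG_cont_diff P).1.
- exact: (compH_cont_diff P).1.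
Qed.

Lemma differentiable_mpccF x : differentiable (mpccF P) x.
Proof.
have [dh dg dG dH] := differentiable_coords x.
apply: differentiable_rowP; apply: idx_ind => i.
- by under eq_fun do rewrite mpccF_h; exact: dh.
- by under eq_fun do rewrite mpccF_g; exact: dg.
- by under eq_fun do rewrite mpccF_G; exact: differentiableN.
- by under eq_fun do rewrite mpccF_H; exact: differentiableN.
Qed.

Section Coordinates.
Context (x u : 'rV[R]_n).

Lemma mulmx_jacobian_h i :
  (u *m 'J (mpccF P) x) 0 (idx_h i) = dot (grad (fun z => eqc P z 0 i) x) u.
Proof.
rewrite mulmx_jacobian; last exact: differentiable_mpccF.
by under eq_fun do rewrite mpccF_h.
Qed.

Lemma mulmx_jacobian_g i :
  (u *m 'J (mpccF P) x) 0 (idx_g i) = dot (grad (fun z => ineqc P z 0 i) x) u.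
Proof.
rewrite mulmx_jacobian; last exact: differentiable_mpccF.
by under eq_fun do rewrite mpccF_g.
Qed.

Lemma mulmx_jacobian_G i :
  (u *m 'J (mpccF P) x) 0 (idx_G i) = - dot (grad (fun z => compG P z 0 i) x) u.
Proof.
rewrite mulmx_jacobian; last exact: differentiable_mpccF.
under eq_fun do rewrite mpccF_G.
by have [_ _ dG _] := differentiable_coords x; rewrite gradN // dotNl.
Qed.

Lemma mulmx_jacobian_H i :
  (u *m 'J (mpccF P) x) 0 (idx_H i) = - dot (grad (fun z => compH P z 0 i) x) u.
Proof.
rewrite mulmx_jacobian; last exact: differentiable_mpccF.
under eq_fun do rewrite mpccF_H.
by have [_ _ _ dH] := differentiable_coords x; rewrite gradN // dotNl.
Qed.

End Coordinates.

Definition mulmx_jacobianE :=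
  (mulmx_jacobian_h, mulmx_jacobian_g, mulmx_jacobian_G, mulmx_jacobian_H).

(** The minus signs of the [G] and [H] entries of [mpccF] account for those of
    the complementarity terms in [grad_comb]. *)
Lemma pack_mul_jacobian_tr x l : pack l *m ('J (mpccF P) x)^T = grad_comb P x l.
Proof.
apply: dot_inj => u; rewrite dot_mulmx_tr [LHS]big_idx.
rewrite /grad_comb dotBl dotDl !dot_suml -addrA; congr (_ + (_ + _)).
- by apply: eq_bigr => i _; rewrite packE mulmx_jacobianE dotZl.
- by apply: eq_bigr => i _; rewrite packE mulmx_jacobianE dotZl.
rewrite -sumrN; apply: eq_bigr => i _.
by rewrite !packE !mulmx_jacobianE dotDl !dotZl !mulrN opprD.
Qed.

End LinearizedMPCC.

(** * Index sets and normals at a feasible point *)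

Section FeasiblePoint.
Context {R : realType} {n mE mI mC : nat} (P : mpcc R n mE mI mC).
Context (x : 'rV[R]_n) (x_feasible : feasible P x).

Lemma eqc_feasible i : eqc P x 0 i = 0.
Proof. by have /mpccDE[/(_ i) + _ _] := x_feasible; rewrite mpccFE. Qed.

Lemma ineqc_feasible i : ineqc P x 0 i <= 0.
Proof. by have /mpccDE[_ /(_ i) + _] := x_feasible; rewrite mpccFE. Qed.

Lemma ineqc_inactive i : i \notin Ig P x -> ineqc P x 0 i < 0.
Proof. by rewrite inE lt_neqAle ineqc_feasible andbT. Qed.

Lemma comp_cases i : [\/ i \in I0p P x, i \in I00 P x | i \in Ip0 P x].
Proof.
have /mpccDE[_ _ /(_ i)] := x_feasible.
rewrite !mpccFE !oppr_le0 mulrNN => -[G0 H0 /eqP GH].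
rewrite !inE; move: GH; rewrite mulf_eq0 => /orP[] /eqP E.
- move: H0; rewrite E eqxx le_eqVlt => /orP[/eqP <-|H0]; last exact: Or31.
  by apply: Or32; rewrite eqxx.
- move: G0; rewrite E eqxx le_eqVlt => /orP[/eqP <-|G0].
    by apply: Or32; rewrite eqxx.
  by apply: Or33; rewrite G0.
Qed.

Lemma I0pF i :
  i \in I0p P x -> (i \in I00 P x = false) * (i \in Ip0 P x = false).
Proof. by rewrite !inE => /andP[/eqP -> H0]; rewrite ltxx eqxx (gt_eqF H0). Qed.

Lemma I00F i :
  i \in I00 P x -> (i \in I0p P x = false) * (i \in Ip0 P x = false).
Proof. by rewrite !inE => /andP[/eqP -> /eqP ->]; rewrite !ltxx eqxx. Qed.

Lemma Ip0F i :
  i \in Ip0 P x -> (i \in I0p P x = false) * (i \in I00 P x = false).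
Proof. by rewrite !inE => /andP[G0 /eqP ->]; rewrite ltxx eqxx (gt_eqF G0). Qed.

(** The multipliers of strong stationarity. *)
Definition strong_multiplier : set (multiplier R mE mI mC) :=
  [set l | [/\ RCC P x l, forall i, i \in Ig P x -> 0 <= mult_g l 0 i
    & forall i, i \in I00 P x -> 0 <= mult_G l 0 i /\ 0 <= mult_H l 0 i]].

(** Each coordinate of [pack l] has a nonpositive product with the same
    coordinate of any tangent direction of [mpccD]. If exactly one member of a
    complementarity pair is zero at [x], the other one stays negative along
    the approximating sequence, which keeps the first at zero. *)
Lemma strong_multiplier_normal l : strong_multiplier l ->
  regular_normal_cone mpccD (mpccF P x) (pack l).
Proof.
move=> [[l_g l_G l_H] lg_ge0 lGH_ge0] z [t [v [t_gt0 t0 vz Dtv]]].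
suff lz : forall j, pack l 0 j * z 0 j <= 0 by exact: sumr_le0.
have Dk k := (mpccDE _).1 (Dtv k).
have move_le k j : mpccF P x 0 j = 0 ->
    (mpccF P x + t k *: v k) 0 j <= 0 -> v k 0 j <= 0.
  by move=> Fj; rewrite coord_move Fj add0r pmulr_rle0.
have move_eq k j : mpccF P x 0 j = 0 ->
    (mpccF P x + t k *: v k) 0 j = 0 -> v k 0 j = 0.
  move=> Fj; rewrite coord_move Fj add0r => /eqP.
  by rewrite mulf_eq0 gt_eqF //= => /eqP.
have move_lt j : mpccF P x 0 j < 0 ->
    \forall k \near \oo, (mpccF P x + t k *: v k) 0 j < 0.
  move=> /(near_moved_coord_lt0 _ _ _ _ _ t0 vz); apply: filterS => k.
  by rewrite coord_move.
apply: idx_ind => i; apply: limit_coord_mul_le0 vz _; rewrite packE.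
- apply: nearW => k; rewrite (move_eq k) ?mulr0 ?mpccFE ?eqc_feasible //.
  by have [] := Dk k.
- have [ig|/l_g ->] := boolP (i \in Ig P x);
    last by apply: nearW => k; rewrite mul0r.
  apply: nearW => k; rewrite mulr_ge0_le0 ?lg_ge0 // move_le //.
    by move: ig; rewrite mpccFE inE => /eqP.
  by have [] := Dk k.
- have [i0p|i00|/l_G ->] := comp_cases i;
    last by apply: nearW => k; rewrite mul0r.
    move: i0p; rewrite inE => /andP[/eqP G0 H0].
    have := move_lt (idx_H i); rewrite mpccFE oppr_lt0 => /(_ H0).
    apply: filterS => k Hk; have [_ _ /(_ i)[_ _ /eqP]] := Dk k.
    rewrite mulf_eq0 (lt_eqF Hk) orbF => /eqP /move_eq -> //.
      by rewrite mulr0.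
    by rewrite mpccFE G0 oppr0.
  have [lG _] := lGH_ge0 _ i00; move: i00; rewrite inE => /andP[/eqP G0 _].
  apply: nearW => k; rewrite mulr_ge0_le0 // move_le ?mpccFE ?G0 ?oppr0 //.
  by have [_ _ /(_ i)[]] := Dk k.
- have [/l_H ->|i00|ip0] := comp_cases i;
    first by apply: nearW => k; rewrite mul0r.
    have [_ lH] := lGH_ge0 _ i00; move: i00; rewrite inE => /andP[_ /eqP H0].
    apply: nearW => k; rewrite mulr_ge0_le0 // move_le ?mpccFE ?H0 ?oppr0 //.
    by have [_ _ /(_ i)[]] := Dk k.
  move: ip0; rewrite inE => /andP[G0 /eqP H0].
  have := move_lt (idx_G i); rewrite mpccFE oppr_lt0 => /(_ G0).
  apply: filterS => k Gk; have [_ _ /(_ i)[_ _ /eqP]] := Dk k.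
  rewrite mulf_eq0 (lt_eqF Gk) /= => /eqP /move_eq -> //.
    by rewrite mulr0.
  by rewrite mpccFE H0 oppr0.
Qed.

(** * Branches of the linearized cone *)

(** The part of the linearized cone in which [A] selects, for every biactive
    index, the component whose linearization is held at zero: that of [G] on
    [A], that of [H] off [A]. *)
Definition branch_cone (A : {set 'I_mC}) : set 'rV[R]_n :=
  [set u | [/\ (forall i, dot (grad (fun z => eqc P z 0 i) x) u = 0),
    (forall i, i \in Ig P x -> dot (grad (fun z => ineqc P z 0 i) x) u <= 0),
    (forall i, i \in (I0p P x :|: A)%SET ->
       dot (grad (fun z => compG P z 0 i) x) u = 0),
    (forall i, i \in (Ip0 P x :|: (I00 P x :\: A))%SET ->
       dot (grad (fun z => compH P z 0 i) x) u = 0)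
   & (forall i, i \in I00 P x ->
        0 <= dot (grad (fun z => compG P z 0 i) x) u /\
        0 <= dot (grad (fun z => compH P z 0 i) x) u)]].

(** Along a direction of the branch the image stays in [mpccD] on a whole
    initial segment: the negative coordinates of [mpccF P x] remain negative
    for small [t], and the zero ones move within their sign constraint while
    the component chosen by [A] keeps each complementarity product at zero. *)
Lemma branch_cone_linearized (A : {set 'I_mC}) :
  A \subset I00 P x -> branch_cone A `<=` linearized_cone P x.
Proof.
move=> /fintype.subsetP A00 u [uh ug uG uH u00]; apply: tangent_cone_near.
near=> t.
have t_gt0 : 0 < t by near: t; exact: nbhs_right_gt.
have neg j : mpccF P x 0 j < 0 ->
    mpccF P x 0 j + t * (u *m 'J (mpccF P) x) 0 j < 0.
  move: j; near: t; apply: filter_forall => j.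
  have [Fj|Fj] := ltP (mpccF P x 0 j) 0; last by apply: nearW.
  by have := near_right_lt0 _ _ ((u *m 'J (mpccF P) x) 0 j) Fj; apply: filterS.
apply/mpccDE; split=> i; rewrite !coord_move.
- by rewrite mulmx_jacobianE uh mulr0 mpccFE eqc_feasible addr0.
- have := neg (idx_g i); rewrite mulmx_jacobianE mpccFE => negi.
  have [ig|/ineqc_inactive/negi/ltW //] := boolP (i \in Ig P x).
  rewrite -[leRHS](addr0 0) lerD ?ineqc_feasible // pmulr_rle0 //; exact: ug.
- have := neg (idx_G i); have := neg (idx_H i).
  rewrite !mulmx_jacobianE !mpccFE !oppr_lt0 => negH negG.
  have [i0p|i00|ip0] := comp_cases i.
  + rewrite uG ?finset.in_setU ?i0p //.
    move: i0p; rewrite inE => /andP[/eqP G0 H0].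
    by rewrite G0 !oppr0 mulr0 addr0 mul0r lexx ltW // negH.
  + have [dG dH] := u00 _ i00; have tG := mulr_ge0 (ltW t_gt0) dG.
    have tH := mulr_ge0 (ltW t_gt0) dH.
    move: (i00); rewrite inE => /andP[/eqP -> /eqP ->].
    rewrite !mulrN oppr0 !add0r !oppr_le0 tG tH mulrNN; split=> //.
    have [iA|iA] := boolP (i \in A).
      by rewrite uG ?mulr0 ?mul0r // finset.in_setU iA orbT.
    by rewrite uH ?mulr0 ?mul0r // finset.in_setU finset.in_setD iA i00 orbT.
  + rewrite uH ?finset.in_setU ?ip0 //.
    move: ip0; rewrite inE => /andP[G0 /eqP H0].
    by rewrite H0 !oppr0 mulr0 addr0 mulr0 lexx ltW // negG.
Unshelve. all: by end_near.
Qed.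

(** The dual description of a branch: the component held at zero has a free
    multiplier, the other one a nonnegative multiplier. *)
Definition branch_multiplier (A : {set 'I_mC}) : set (multiplier R mE mI mC) :=
  [set l | [/\ RCC P x l, forall i, i \in Ig P x -> 0 <= mult_g l 0 i,
    forall i, i \in (I00 P x :\: A)%SET -> 0 <= mult_G l 0 i
    & forall i, i \in A -> 0 <= mult_H l 0 i]].

(** Farkas' lemma for the signed gradients of the constraints that enter the
    definition of the branch. *)
Lemma polar_branch_cone (A : {set 'I_mC}) y :
  A \subset I00 P x -> polar (branch_cone A) y ->
  exists2 l, branch_multiplier A l & y = grad_comb P x l.
Proof.
move=> /fintype.subsetP A00 ypol.
pose I : finType := (('I_mE + 'I_mI) + ('I_mC + 'I_mC))%type.
pose a (s : I) : 'rV[R]_n := match s with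
  | inl (inl i) => grad (fun z => eqc P z 0 i) x
  | inl (inr i) => grad (fun z => ineqc P z 0 i) x
  | inr (inl i) => - grad (fun z => compG P z 0 i) x
  | inr (inr i) => - grad (fun z => compH P z 0 i) x end.
pose eqs (s : I) := match s with
  | inl (inl i) => true
  | inl (inr i) => false
  | inr (inl i) => i \in (I0p P x :|: A)%SET
  | inr (inr i) => i \in (Ip0 P x :|: (I00 P x :\: A))%SET end.
pose les (s : I) := match s with
  | inl (inl i) => false
  | inl (inr i) => i \in Ig P x
  | inr (inl i) | inr (inr i) => i \in I00 P x end.
pose s := [seq k <- enum I | eqs k || les k].
have sE k : (k \in s) = eqs k || les k by rewrite mem_filter mem_enum andbT.
have [//||c yE c_ge0] := @farkas R n I s eqs a y.
- by rewrite filter_uniq ?enum_uniq.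
- move=> u u_eq u_le.
  have u0 k : eqs k -> dot (a k) u = 0 by move=> ek; rewrite u_eq ?sE ?ek.
  have un k : les k -> dot (a k) u <= 0.
    move=> lk; have [/u0 -> //|ek] := boolP (eqs k).
    by apply: u_le => //; rewrite sE lk orbT.
  apply: ypol; split=> i.
  + exact: (u0 (inl (inl i))).
  + exact: (un (inl (inr i))).
  + by move=> /(u0 (inr (inl i))) /eqP; rewrite dotNl oppr_eq0 => /eqP.
  + by move=> /(u0 (inr (inr i))) /eqP; rewrite dotNl oppr_eq0 => /eqP.
  + move=> i00; have := un (inr (inl i)) i00; have := un (inr (inr i)) i00.
    by rewrite !dotNl !oppr_le0.
(* Extending by zero to the constraints left out of [s] gives the vanishing
   components that [RCC] demands. *)
pose c' k := if eqs k || les k then c k else 0.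
have c'_ge0 k : les k -> ~~ eqs k -> 0 <= c' k.
  by move=> lk ek; rewrite /c' lk orbT c_ge0 // sE lk orbT.
exists (Multiplier (\row_i c' (inl (inl i))) (\row_i c' (inl (inr i)))
  (\row_i c' (inr (inl i))) (\row_i c' (inr (inr i)))).
- split; first split; move=> i; rewrite /= mxE.
  + by rewrite /c' /= => /negPf ->.
  + move=> /Ip0F[i0p i00]; rewrite /c' /= finset.in_setU i0p i00 orbF /=.
    by case: ifP => // /A00; rewrite i00.
  + move=> /I0pF[i00 ip0].
    by rewrite /c' /= finset.in_setU finset.in_setD ip0 i00 andbF.
  + by move=> ig; exact: c'_ge0.
  + rewrite finset.in_setD => /andP[iA i00]; apply: c'_ge0 => //=.
    by rewrite finset.in_setU (I00F _ i00) (negPf iA).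
  + move=> iA; have i00 := A00 i iA; apply: c'_ge0 => //=.
    by rewrite finset.in_setU finset.in_setD (I00F _ i00) iA.
- rewrite yE /s big_filter big_mkcond big_enum /=.
  rewrite (eq_bigr (fun k => c' k *: a k)); last first.
    by move=> k _; rewrite /c'; case: ifP => // _; rewrite scale0r.
  rewrite !big_sumType /= /grad_comb; congr (_ + _ + _).
  + by apply: eq_bigr => i _; rewrite mxE.
  + by apply: eq_bigr => i _; rewrite mxE.
  + rewrite -big_split -sumrN; apply: eq_bigr => i _.
    by rewrite !mxE /= !scalerN opprD.
Qed.

End FeasiblePoint.

(** * The chain of inclusions *)

Definition subm {R : realType} {mE mI mC : nat}
    (l mu : multiplier R mE mI mC) :=
  Multiplier (mult_h l - mult_h mu) (mult_g l - mult_g mu)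
             (mult_G l - mult_G mu) (mult_H l - mult_H mu).

Section Inclusions.
Context {R : realType} {n mE mI mC : nat} (P : mpcc R n mE mI mC).
Context (x : 'rV[R]_n).
Implicit Types l mu : multiplier R mE mI mC.

Lemma pack_subm l mu : pack (subm l mu) = pack l - pack mu.
Proof.
apply/rowP; apply: idx_ind => i;
  by rewrite -[pack mu]scale1r -scaleNr coord_move !packE mulN1r !mxE.
Qed.

Lemma grad_comb_subm l mu :
  grad_comb P x (subm l mu) = grad_comb P x l - grad_comb P x mu.
Proof. by rewrite -!pack_mul_jacobian_tr pack_subm mulmxBl. Qed.

Lemma RCC_subm l mu : RCC P x l -> RCC P x mu -> RCC P x (subm l mu).
Proof.
move=> [lg lG lH] [mg mG mH]; split=> i ix; rewrite !mxE.
- by rewrite lg ?mg ?subrr.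
- by rewrite lG ?mG ?subrr.
- by rewrite lH ?mH ?subrr.
Qed.

Lemma adjoint_normal_sub_polar :
  adjoint_image P x (regular_normal_cone mpccD (mpccF P x)) `<=`
  polar (linearized_cone P x).
Proof. by move=> _ [y yN <-] u uL; rewrite dot_mulmx_tr; exact: yN. Qed.

(** Two branches that hold opposite components at zero give two multipliers of
    [y], and their difference is the required element of [NCC]. The branch
    [beta1] supplies the multiplier itself, since [MCC] asks for nonnegative
    [H]-components on [beta1] and [G]-components on [beta2]. *)
Lemma polar_linearized_sub_MCC (beta1 beta2 : {set 'I_mC}) :
  feasible P x -> is_partition_I00 P x beta1 beta2 ->
  polar (linearized_cone P x) `<=` MCC P x beta1 beta2.
Proof.
move=> xF [b12U b12I] y ypol.
have b1_00 : beta1 \subset I00 P x by rewrite -b12U finset.subsetUl.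
have b2_00 : beta2 \subset I00 P x by rewrite -b12U finset.subsetUr.
have b1N i : i \in beta1 -> i \in (I00 P x :\: beta2)%SET.
  move=> i1; rewrite finset.in_setD (fintype.subsetP b1_00) // andbT.
  apply/negP => i2.
  have : i \in (beta1 :&: beta2)%SET by rewrite finset.in_setI i1.
  by rewrite b12I finset.in_set0.
have b2N i : i \in beta2 -> i \in (I00 P x :\: beta1)%SET.
  move=> i2; rewrite finset.in_setD (fintype.subsetP b2_00) // andbT.
  apply/negP => i1.
  have : i \in (beta1 :&: beta2)%SET by rewrite finset.in_setI i1.
  by rewrite b12I finset.in_set0.
have sub_polar (A : {set 'I_mC}) :
    A \subset I00 P x -> polar (branch_cone P x A) y.
  move=> A00 u uA; apply: ypol.
  by exact: (branch_cone_linearized P x xF A A00 u uA).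
have [l [lR lg lG lH] yl] :=
  polar_branch_cone P x _ _ b1_00 (sub_polar _ b1_00).
have [l' [lR' lg' lG' lH'] yl'] :=
  polar_branch_cone P x _ _ b2_00 (sub_polar _ b2_00).
exists l; last by rewrite yl.
split=> //; exists (subm l l').
  by split; [exact: RCC_subm | rewrite grad_comb_subm -yl -yl' subrr].
split=> i ib; rewrite !mxE.
- by rewrite ge_max lg // gerBl lg'.
- by rewrite gerBl lG' ?b1N // lH.
- by rewrite gerBl lH' // lG // b2N.
Qed.

(** Moving from [l] to [l - mu] does not change the vector, and one of the two
    is nonnegative at the biactive indices by the sign condition. *)
Lemma MCC_sub_adjoint_normal (beta1 beta2 : {set 'I_mC}) :
  feasible P x -> is_partition_I00 P x beta1 beta2 ->
  (forall mu, NCC P x mu ->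
      [/\ forall i i', i \in beta1 -> i' \in beta2 ->
            0 <= mult_G mu 0 i * mult_G mu 0 i' /\
            0 <= mult_H mu 0 i * mult_H mu 0 i',
          forall i i', i \in beta1 -> i' \in beta1 ->
            0 <= mult_G mu 0 i * mult_H mu 0 i'
        & forall i i', i \in beta2 -> i' \in beta2 ->
            0 <= mult_G mu 0 i * mult_H mu 0 i']) ->
  MCC P x beta1 beta2 `<=`
  adjoint_image P x (regular_normal_cone mpccD (mpccF P x)).
Proof.
move=> xF [b12U _] sgn _ [l [lR [mu muN [lmg l1 l2]] <-]].
have [muR mu0] := muN.
have [sgn12 sgn11 sgn22] := sgn mu muN.
suff [nu nuS <-] : exists2 nu, strong_multiplier P x nu &
    grad_comb P x nu = grad_comb P x l.
  exists (pack nu); first exact: strong_multiplier_normal.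
  exact: pack_mul_jacobian_tr.
have lg i : i \in Ig P x -> 0 <= mult_g l 0 i /\ mult_g mu 0 i <= mult_g l 0 i.
  by move=> /lmg; rewrite ge_max => /andP[].
have [mu_ge0|neg] := pselect ((forall i, i \in beta1 -> 0 <= mult_G mu 0 i) /\
                              (forall i, i \in beta2 -> 0 <= mult_H mu 0 i)).
  exists l => //; split=> // i; first by move=> /lg[].
  rewrite -b12U finset.in_setU => /orP[ib|ib].
    by have [lG lH] := l1 _ ib; split=> //; exact: le_trans (mu_ge0.1 _ ib) lG.
  by have [lG lH] := l2 _ ib; split=> //; exact: le_trans (mu_ge0.2 _ ib) lH.
have nonpos (a b : R) : a < 0 -> 0 <= a * b -> b <= 0.
  by move=> a0; rewrite nmulr_rge0.
(* A single negative component [k] of [mu] settles the sign of [mu] in the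
   components where [l] is only known to be nonnegative. *)
have [mu1 mu2] : (forall i, i \in beta1 -> mult_H mu 0 i <= 0) /\
                 (forall i, i \in beta2 -> mult_G mu 0 i <= 0).
  move/not_andP: neg => -[] /existsNP[k /not_implyP[kb /negP]];
    rewrite -ltNge => k0.
    split=> i ib; apply: nonpos k0 _; first exact: sgn11.
    by have [] := sgn12 _ _ kb ib.
  split=> i ib; apply: nonpos k0 _; last by rewrite mulrC; exact: sgn22.
  by rewrite mulrC; have [] := sgn12 _ _ ib kb.
exists (subm l mu); last by rewrite grad_comb_subm mu0 subr0.
split=> [|i /lg[_ ?]|i]; first exact: RCC_subm.
  by rewrite !mxE subr_ge0.
rewrite -b12U finset.in_setU !mxE !subr_ge0 => /orP[ib|ib].
  by have [lG lH] := l1 _ ib; split=> //; exact: le_trans (mu1 _ ib) lH.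
by have [lG lH] := l2 _ ib; split=> //; exact: le_trans (mu2 _ ib) lG.
Qed.

End Inclusions.

Theorem theorem5 (R : realType) (n mE mI mC : nat) (P : mpcc R n mE mI mC)
    (xbar : 'rV[R]_n) (beta1 beta2 : {set 'I_mC})
    (xbar_feasible : feasible P xbar)
    (xbar_GGCQ : GGCQ P xbar)
    (beta_partition : is_partition_I00 P xbar beta1 beta2)
    (sign_condition : forall mu : multiplier R mE mI mC, NCC P xbar mu ->
      [/\ forall i i', i \in beta1 -> i' \in beta2 ->
            0 <= mult_G mu 0 i * mult_G mu 0 i' /\
            0 <= mult_H mu 0 i * mult_H mu 0 i',
          forall i i', i \in beta1 -> i' \in beta1 ->
            0 <= mult_G mu 0 i * mult_H mu 0 i'
        & forall i i', i \in beta2 -> i' \in beta2 ->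
            0 <= mult_G mu 0 i * mult_H mu 0 i']) :
  regular_normal_cone (feasible P) xbar = MCC P xbar beta1 beta2 /\
  MCC P xbar beta1 beta2
    = adjoint_image P xbar
        (regular_normal_cone mpccD (mpccF P xbar)).
Proof.
have NL :
    regular_normal_cone (feasible P) xbar = polar (linearized_cone P xbar).
  exact: xbar_GGCQ.
have LM := polar_linearized_sub_MCC P xbar _ _ xbar_feasible beta_partition.
have MN := MCC_sub_adjoint_normal P xbar _ _ xbar_feasible beta_partition
  sign_condition.
have NA := adjoint_normal_sub_polar P xbar.
rewrite NL; split; apply/seteqP; split=> //.
- exact: subset_trans MN NA.
- exact: subset_trans NA LM.
Qed.
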